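(* Consider the semi-infinite program (SIP) and the central cutting-surface algorithm described in the context, run with tolerance $\varepsilon$. (a) The algorithm either finds an $\varepsilon$-optimal solution of (SIP) in finitely many iterations or generates a sequence $\{\widetilde{x}^{(k)}\}_{k=1}^\infty$ such that each accumulation point is an $\varepsilon$-optimal solution of (SIP). (b) The algorithm converges linearly in objective function value between consecutive feasibility cuts. The rate of convergence $\rho$ satisfies $$\rho\le 1-\frac{1}{2B'+1},$$ where $B':=\max\{\sqrt{r_0^2+1+(1/m)},\ \sqrt{B^2+L^2+1}\}$ and $L=\max\{d(s,\xi^i):\ s\in\Xi,\ i\in[m]\}$.
   Context: Setting. $[m]=\{1,\dots,m\}$. $(\Xi,\mathcal{F})$ is a measurable space, where $\Xi\subseteq\mathbb{R}^n$ and $\mathcal{F}$ is a $\sigma$-algebra containing all singletons of $\Xi$. $d$ is a metric on $\Xi$, measurable with respect to $\mathcal{F}\times\mathcal{F}$; $\xi^1,\dots,\xi^m\in\Xi$ are observed samples. Assumptions: $r_0>0$; $\Theta\subseteq\mathbb{R}^n$ and $\Xi$ are compact; $h:\Theta\times\Xi\to\mathbb{R}$ is continuous in $\theta$ and bounded on $\Theta\times\Xi$; for every $\theta\in\Theta$ there is $C(\theta)>0$ with $|h(\theta,s_1)-h(\theta,s_2)|\le C(\theta)d(s_1,s_2)$ for all $s_1,s_2\in\Xi$; $\Theta$ is convex and $h(\cdot,s)$ is convex for every $s\in\Xi$; and there is a parameter $B$ with $B>\|\eta\|$ for all $\eta\in\partial_\theta h(\theta,s)$, $\theta\in\Theta$,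 $s\in\Xi$, where $\partial_\theta h(\theta,s)$ is the subdifferential of $h(\cdot,s)$ at $\theta$. With $C_1,C_2$ lower and upper bounds of $h$ on $\Theta\times\Xi$, let $\mathcal{H}=\{v\in\mathbb{R}^{m+1}:\ C_1\le v_i\le(m+1)C_2-mC_1\ (i\in[m]),\ 0\le v_{m+1}\le(C_2-C_1)/r_0\}$ and $X=\Theta\times\mathcal{H}$. For $x=[\theta,v]$ define $f(x)=\frac1m\sum_{i=1}^m v_i+r_0v_{m+1}$ and $g_i(x,s)=h(\theta,s)-v_i-v_{m+1}d(s,\xi^i)$, $i\in[m]$. (SIP) is $$\min_{x\in X}\ f(x)\quad\text{s.t.}\quad g_i(x,s)\le0,\ \ s\in\Xi,\ i\in[m].$$ Let $f^*$ be its optimal value. A point $x\in X$ is $\varepsilon$-feasible if $\max_{i\in[m],\,s\in\Xi}g_i(x,s)\le\varepsilon$, and $\varepsilon$-optimal if it is $\varepsilon$-feasible and $f(x)\le f^*$. Separation problem for $x$ and $i\in[m]$: $\max_{s\in\Xi}g_i(x,s)$. An oracle is available that finds an $\varepsilon$-optimal solution of it, for any $\varepsilon>0$. The master problem at iteration $k$ is $$\max_{x\in X,\,w,\,t}\ w\quad\text{s.t.}\quad t+w\le M^{(k-1)},\quad f(x)-t+Bw\le0,\quad g_i(x,s)+Bw\le0\ \ \forall i\in[m],\ s\in Q^{(k-1)},$$ assumed to be solved to optimality. Central cutting-surface algorithm. Input: a strict upper bound $U$ of the function $h$, a centering parameter $B>0$ satisfying $B>\|\eta\|$ for all $\eta\in\partial_\theta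 h(\theta,s)$, $\theta\in\Theta$, $s\in\Xi$, a tolerance $\varepsilon>0$, and $\alpha>1$. Step 1. Set $k\leftarrow1$, $M^{(0)}\leftarrow U$, $x^{(0)}\leftarrow[\theta^0,\mathbf{0}_{m+1}]$, $\widetilde{x}^{(0)}\leftarrow x^{(0)}$, where $\theta^0$ solves $\min_{\theta\in\Theta}\frac1m\sum_{i=1}^m h(\theta,\xi^i)$; $Q^{(0)}\leftarrow\{s^{(0)}\}$ for an initial point $s^{(0)}\in\Xi$. Step 2. Determine an optimal solution $(x^{(k)},w^{(k)})$ of the master problem. Step 3. If $w^{(k)}=0$, stop and return $\widetilde{x}^{(k-1)}$. Step 4. Find $\varepsilon$-optimal solutions of the separation problems at $x^{(k)}$ using the oracle. If the solution $s^{(k)}$ found for some $i$ satisfies $g_i(x^{(k)},s^{(k)})>0$, go to Step 5; otherwise go to Step 6. Step 5 (feasibility cut). Set $Q^{(k)}\leftarrow Q^{(k-1)}\cup\{s^{(k)}\}$, $\widetilde{x}^{(k)}\leftarrow\widetilde{x}^{(k-1)}$, $M^{(k)}\leftarrow M^{(k-1)}$; go to Step 7. Step 6 (update of best known $\varepsilon$-feasible solution). Set $Q^{(k)}\leftarrow Q^{(k-1)}$, $\widetilde{x}^{(k)}\leftarrow x^{(k)}$, $M^{(k)}\leftarrow f(x^{(k)})$. Step 7. Optionally drop cuts: let $D$ be the set of $s^{(l)}\in Q^{(k)}$, $l\in\{0,\dots,k\}$, with $w^{(l)}\ge\alpha w^{(k)}$ and $g_i(x^{(k)},s^{(l)})+Bw^{(k)}<0$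 for all $i$, and set $Q^{(k)}\leftarrow Q^{(k)}\setminus D$. Set $k\leftarrow k+1$ and go to Step 2. Rate of convergence: the one-step ratio is $\rho^{(k)}=\dfrac{f(\widetilde{x}^{(k)})-f^*}{f(\widetilde{x}^{(k-1)})-f^*}$, and $\rho$ denotes a uniform bound for $\rho^{(k)}$ over the iterations $k$ between consecutive feasibility cuts (iterations in which the best known solution is updated in Step 6).
   Formalization: h(·,s) is assumed convex on an open convex set containing Θ, with subdifferentials taken there; C₁<C₂; U exceeds sup h; a re-generated cut counts as new; (b) covers only Step 6 updates whose previous best solution came from an earlier Step 6 and has value above f*. *)

(* Defs.v *)
From HB Require Import structures.
From mathcomp Require Import all_boot all_order all_algebra.
From mathcomp Require Import all_classical all_reals all_analysis.

Set Implicit Arguments.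
Unset Strict Implicit.
Unset Printing Implicit Defensive.

Import Order.TTheory GRing.Theory Num.Theory.
Import numFieldNormedType.Exports.

Local Open Scope classical_set_scope.
Local Open Scope ring_scope.

(* MathComp-Analysis norms row vectors by the sup norm; the theorem is about
   the Euclidean one. *)
Definition dotv (R : realType) (n : nat) (u v : 'rV[R]_n) : R :=
  \sum_(j < n) u 0 j * v 0 j.

Definition enorm (R : realType) (n : nat) (u : 'rV[R]_n) : R :=
  Num.sqrt (dotv u u).

Definition subdifferential (R : realType) (n : nat) (D : set 'rV[R]_n)
    (phi : 'rV[R]_n -> R) (theta : 'rV[R]_n) : set 'rV[R]_n :=
  [set eta | forall theta', D theta' ->
     phi theta + dotv eta (theta' - theta) <= phi theta'].

(* Only the values of [h] on [Omega * Xi] and of [d] on [Xi * Xi] matter.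
   [Omega] is a neighbourhood of [Theta] on which the functions [h ^~ s] are
   defined and convex, and to which their subdifferentials refer. It cannot be
   [Theta] itself: relative to a nonempty compact convex set in dimension
   n >= 1 the subgradients of a continuous convex function are never bounded,
   because of the normal cones at the boundary. *)
Record problem (R : realType) (n m : nat) := Problem {
  Theta : set 'rV[R]_n;
  Omega : set 'rV[R]_n;
  Xi : set 'rV[R]_n;
  Xi_events : set (set 'rV[R]_n);
  d : 'rV[R]_n -> 'rV[R]_n -> R;
  sample : 'I_m -> 'rV[R]_n;
  h : 'rV[R]_n -> 'rV[R]_n -> R;
  r0 : R;
  C1 : R;
  C2 : R }.

Definition is_metric_on (R : realType) (T : Type) (D : set T)
    (dist : T -> T -> R) : Prop :=
  [/\ forall a b, D a -> D b -> 0 <= dist a b,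
      forall a b, D a -> D b -> (dist a b = 0 <-> a = b),
      forall a b, D a -> D b -> dist a b = dist b a &
      forall a b c, D a -> D b -> D c -> dist a c <= dist a b + dist b c].

Record assumptions (R : realType) (n m : nat) (P : problem R n m) (B : R)
    : Prop := Assumptions {
  m_gt0 : (0 < m)%N;
  events_sub : forall A, Xi_events P A -> A `<=` Xi P;
  events_sigma : sigma_algebra (Xi P) (Xi_events P);
  events_singleton : forall s, Xi P s -> Xi_events P [set s];
  d_metric : is_metric_on (Xi P) (d P);
  d_measurable : forall Y : set R, measurable Y ->
    <<s Xi P `*` Xi P,
      [set A1 `*` A2 | A1 in Xi_events P & A2 in Xi_events P] >>
    [set p | (Xi P `*` Xi P) p /\ Y (d P p.1 p.2)];
  sample_in : forall i, Xi P (sample P i);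
  r0_gt0 : 0 < r0 P;
  Theta_compact : compact (Theta P);
  Xi_compact : compact (Xi P);
  h_continuous : forall s, Xi P s ->
    {within Theta P, continuous (fun theta => h P theta s)};
  h_bounded : forall theta s, Theta P theta -> Xi P s ->
    C1 P <= h P theta s <= C2 P;
  (* For C1 = C2 the box of the v-variables is a single point, the first
     master problem has value 0 and the method returns its starting point. *)
  C1_lt_C2 : C1 P < C2 P;
  h_lipschitz : forall theta, Theta P theta -> exists C : R, 0 < C /\
    forall s1 s2, Xi P s1 -> Xi P s2 ->
      `|h P theta s1 - h P theta s2| <= C * d P s1 s2;
  Theta_convex : convex_set (Theta P);
  Omega_open : open (Omega P);
  Omega_convex : convex_set (Omega P);
  Theta_sub_Omega : Theta P `<=` Omega P;
  h_convex : forall s, Xi P s ->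
    convex_function (Omega P) (fun theta => h P theta s);
  B_gt0 : 0 < B;
  B_subgradient : forall theta s eta, Theta P theta -> Xi P s ->
    subdifferential (Omega P) (fun theta' => h P theta' s) theta eta ->
    enorm eta < B }.

Definition point (R : realType) (n m : nat) : Type :=
  ('rV[R]_n * 'rV[R]_m.+1)%type.

Section SIP.
Variables (R : realType) (n m : nat) (P : problem R n m).
Implicit Types (x : point R n m) (v : 'rV[R]_m.+1) (s : 'rV[R]_n) (i : 'I_m).

Definition vi v i : R := v 0 (widen_ord (leqnSn m) i).
Definition vlast v : R := v 0 ord_max.

Definition Hbox : set 'rV[R]_m.+1 :=
  [set v | (forall i, C1 P <= vi v i <= m.+1%:R * C2 P - m%:R * C1 P) /\
           0 <= vlast v <= (C2 P - C1 P) / r0 P].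

Definition X : set (point R n m) := Theta P `*` Hbox.

Definition f x : R :=
  m%:R^-1 * (\sum_(i < m) vi x.2 i) + r0 P * vlast x.2.

Definition g i x s : R :=
  h P x.1 s - vi x.2 i - vlast x.2 * d P s (sample P i).

Definition feasible : set (point R n m) :=
  [set x | X x /\ forall i s, Xi P s -> g i x s <= 0].

Definition fstar : R := inf (f @` feasible).

Definition eps_feasible (eps : R) x : Prop :=
  X x /\ forall i s, Xi P s -> g i x s <= eps.

Definition eps_optimal (eps : R) x : Prop :=
  eps_feasible eps x /\ f x <= fstar.

Definition eps_separation (eps : R) x i s : Prop :=
  Xi P s /\ forall s', Xi P s' -> g i x s' <= g i x s + eps.

(* U is required to exceed this supremum, not just every value of h: h need
   not attain it, as h theta is continuous in s only with respect to d. *)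
Definition h_sup : R :=
  sup [set h P p.1 p.2 | p in Theta P `*` Xi P].

(* A cut is identified with the iteration that generated it: [cuts k] contains
   the label l of the cut [cut_point l] rather than the point itself, so that a point
   which is dropped and later generated again is a new cut, with the master
   value of the later iteration. [mvalue 0] and the values of the fields that
   an iteration leaves undefined are arbitrary. *)
Record trace := Trace {
  iterate : nat -> point R n m;        (* x^(k) *)
  mvalue : nat -> R;                   (* w^(k) *)
  answer : nat -> 'I_m -> 'rV[R]_n;    (* oracle solution at x^(k) for each i *)
  cut_point : nat -> 'rV[R]_n;         (* s^(k) *)
  cuts : nat -> set nat;               (* Q^(k) *)
  best : nat -> point R n m;           (* best known solution *)
  level : nat -> R }.                  (* M^(k) *)

Variables (B U eps alpha : R) (r : trace).
Implicit Types (k l : nat) (Q : set nat).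

Definition master_feasible k x (w t : R) : Prop :=
  [/\ X x,
      t + w <= level r k.-1,
      f x - t + B * w <= 0 &
      forall i l, cuts r k.-1 l -> g i x (cut_point r l) + B * w <= 0].

Definition master_optimal k x (w : R) : Prop :=
  (exists t, master_feasible k x w t) /\
  (forall x' w' t', master_feasible k x' w' t' -> w' <= w).

Definition reached k : Prop :=
  (0 < k)%N /\ forall j, (0 < j < k)%N -> mvalue r j <> 0.

Definition stops_at k : Prop := reached k /\ mvalue r k = 0.

Definition never_stops : Prop := forall k, (0 < k)%N -> mvalue r k <> 0.

Definition step1 : Prop :=
  [/\ level r 0 = U,
      exists theta0,
        [/\ Theta P theta0,
            forall theta, Theta P theta ->
              m%:R^-1 * (\sum_(i < m) h P theta0 (sample P i)) <=
              m%:R^-1 * (\sum_(i < m) h P theta (sample P i)) &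
            iterate r 0 = (theta0, 0)],
      best r 0 = iterate r 0,
      cuts r 0 = [set 0%N] &
      Xi P (cut_point r 0)].

Definition feasibility_cut k Q : Prop :=
  [/\ exists2 i, cut_point r k = answer r k i & 0 < g i (iterate r k) (cut_point r k),
      Q = cuts r k.-1 `|` [set k],
      best r k = best r k.-1 &
      level r k = level r k.-1].

Definition no_violation k : Prop :=
  forall i, g i (iterate r k) (answer r k i) <= 0.

Definition best_update k Q : Prop :=
  [/\ no_violation k,
      Q = cuts r k.-1,
      best r k = iterate r k &
      level r k = f (iterate r k)].

Definition droppable k Q : set nat :=
  [set l | [/\ Q l, (l <= k)%N, alpha * mvalue r k <= mvalue r l &
     forall i, g i (iterate r k) (cut_point r l) + B * mvalue r k < 0]].

Definition cut_dropping k Q : Prop :=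
  cuts r k = Q \/ cuts r k = Q `\` droppable k Q.

Definition run : Prop :=
  [/\ step1,
      forall k, reached k -> master_optimal k (iterate r k) (mvalue r k) &
      forall k, reached k -> mvalue r k <> 0 ->
        (forall i, eps_separation eps (iterate r k) i (answer r k i)) /\
        exists2 Q, feasibility_cut k Q \/ best_update k Q & cut_dropping k Q].

Definition update_iteration k : Prop :=
  [/\ reached k, mvalue r k <> 0 & no_violation k].

Definition one_step_ratio k : R :=
  (f (best r k) - fstar) / (f (best r k.-1) - fstar).

(* The updates whose predecessor in the ratio is an actual approximate
   solution (not the starting point, which is neither in X nor related to the
   level U) whose value still exceeds the optimal one. *)
Definition rate_iteration k : Prop :=
  [/\ update_iteration k,
      exists2 j, (j < k)%N & update_iteration j &
      fstar < f (best r k.-1)].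

Definition is_max_distance (L : R) : Prop :=
  (forall s i, Xi P s -> d P s (sample P i) <= L) /\
  (exists s i, Xi P s /\ d P s (sample P i) = L).

Definition Bprime (L : R) : R :=
  Num.max (Num.sqrt (r0 P ^+ 2 + 1 + m%:R^-1)) (Num.sqrt (B ^+ 2 + L ^+ 2 + 1)).

End SIP.

(* Main.v *)
(* As long as the level exceeds fstar, raising the v_i of a nearly optimal
   feasible point by a small amount shows that the master value is positive,
   uniformly while the level stays away from fstar. Once the level is at most
   fstar, the iterates keep an objective value at most fstar, so every later
   best solution is eps-optimal. Otherwise the master values are nonincreasing;
   were they bounded below by a positive number, there would eventually be only
   feasibility cuts, none of them dropped, which contradicts the compactness of
   X because the constraints are equi-Lipschitz in theta (bounded subgradients,
   whose existence is a finite-dimensional Hahn-Banach argument). So the levels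
   tend to fstar. The same raised point gives
   w >= gap / ((1 + B) (2 B' + 1)), hence the rate in (b). *)

Require Import Defs.
From HB Require Import structures.
From mathcomp Require Import all_boot all_order all_algebra.
From mathcomp Require Import all_classical all_reals all_analysis.
From mathcomp Require Import ring lra.

Set Implicit Arguments.
Unset Strict Implicit.
Unset Printing Implicit Defensive.

Import Order.TTheory GRing.Theory Num.Theory.
Import numFieldNormedType.Exports.

Local Open Scope classical_set_scope.
Local Open Scope ring_scope.

(** * The Hahn-Banach theorem in finite dimension *)

Section FiniteDimensionalHahnBanach.
Variables (R : realType).

Definition sublinear (V : lmodType R) (p : V -> R) : Prop :=
  (forall u v, p (u + v) <= p u + p v) /\
  (forall c u, 0 <= c -> p (c *: u) <= c * p u).

(** Serves twice below: for the linearization along a direction and for the directional derivative,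
    both infima of this kind. *)
Lemma sublinear_inf (V : lmodType R) (S : V -> set R) :
  (forall u, has_inf (S u)) ->
  (forall u v a b, S u a -> S v b -> exists2 c, S (u + v) c & c <= a + b) ->
  (forall c u a, 0 <= c -> S u a -> exists2 b, S (c *: u) b & b <= c * a) ->
  sublinear (fun u => inf (S u)).
Proof.
move=> S_inf SD SZ; split=> [u v|c u c_ge0].
- rewrite -lerBlDr; apply: lb_le_inf => [|a Sua]; first by case: (S_inf u).
  rewrite lerBlDr -lerBlDl; apply: lb_le_inf => [|b Svb].
    by case: (S_inf v).
  have [e Suve le_e] := SD _ _ _ _ Sua Svb.
  rewrite lerBlDl; apply: le_trans le_e.
  by apply: ge_inf => //; case: (S_inf (u + v)).
- have infZ a : S u a -> inf (S (c *: u)) <= c * a.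
    move=> Sua; have [b Scub le_b] := SZ _ _ _ c_ge0 Sua.
    by apply: le_trans le_b; apply: ge_inf => //; case: (S_inf (c *: u)).
  have [[a Sua] _] := S_inf u.
  have [c0|c_neq0] := eqVneq c 0.
    by have := infZ _ Sua; rewrite c0 !mul0r.
  have c_gt0 : 0 < c by rewrite lt_neqAle eq_sym c_neq0.
  rewrite -ler_pdivrMl//; apply: lb_le_inf; first by exists a.
  by move=> b Sub; rewrite ler_pdivrMl//; exact: infZ.
Qed.

Section Sublinear.
Variables (V : lmodType R) (p : V -> R).
Hypothesis p_sub : sublinear p.

Lemma sublinear0 : p 0 = 0.
Proof.
case: p_sub => pD pZ; have := pD 0 0; have := pZ 0 0 (lexx _).
by rewrite scaler0 addr0; lra.
Qed.

Lemma sublinear_ge u : - p (- u) <= p u.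
Proof.
by case: p_sub => pD _; have := pD u (- u); rewrite subrr sublinear0; lra.
Qed.

Lemma sublinearZ_ge c u : 0 <= c -> c * p u <= p (c *: u).
Proof.
case: p_sub => _ pZ; rewrite le_eqVlt => /orP[/eqP<-|c_gt0].
  by rewrite mul0r scale0r sublinear0.
have ci_ge0 : 0 <= c^-1 by rewrite invr_ge0 ltW.
have := pZ _ (c *: u) ci_ge0.
by rewrite scalerA mulVf ?gt_eqF// scale1r -ler_pdivlMl ?invr_gt0// invrK.
Qed.

(* Passing to [q (u) = inf_{t >= 0} p (u + t e) - t p e] makes a sublinear
   functional linear along [e]. *)
Lemma sublinear_linearize (e : V) : exists q : V -> R,
  [/\ sublinear q, forall u, q u <= p u & q (- e) <= - q e].
Proof.
pose S u := [set p (u + t *: e) - t * p e | t in [set t | 0 <= t]].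
have S0 u : S u (p u) by exists 0 => /=; rewrite // scale0r mul0r addr0 subr0.
have S_inf u : has_inf (S u).
  split; first by exists (p u).
  exists (- p (- u)) => _ [t /= t_ge0 <-].
  (* The lower bound comes from t p(e) <= p(t e) <= p(u + t e) + p(-u). *)
  have := sublinearZ_ge e t_ge0; case: p_sub => pD _.
  by have := pD (u + t *: e) (- u); rewrite addrAC subrr add0r; lra.
have le_qp u : inf (S u) <= p u by apply: ge_inf => //; case: (S_inf u).
exists (fun u => inf (S u)); case: (p_sub) => pD pZ; split=> //.
- apply: sublinear_inf => // [u v _ _ [s /= s_ge0 <-] [t /= t_ge0 <-]|].
    exists (p (u + v + (s + t) *: e) - (s + t) * p e).
      by exists (s + t); rewrite //= addr_ge0.
    have := pD (u + s *: e) (v + t *: e).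
    by rewrite addrACA -scalerDl; lra.
  move=> c u _ c_ge0 [t /= t_ge0 <-].
  exists (p (c *: u + (c * t) *: e) - (c * t) * p e).
    by exists (c * t); rewrite //= mulr_ge0.
  by have := pZ c (u + t *: e) c_ge0; rewrite scalerDr scalerA; lra.
- have : inf (S (- e)) <= - p e.
    apply: ge_inf; first by case: (S_inf (- e)).
    by exists 1 => //=; rewrite scale1r addNr sublinear0; lra.
  by have := le_qp e; lra.
Qed.

End Sublinear.

(** Linearity along an earlier [e j] survives later steps, because lowering [q] to [q'] gives
    q'(-e_j) <= q(-e_j) <= -q(e_j) <= -q'(e_j). *)
Lemma sublinear_linearize_seq (V : lmodType R) (I : Type) (e : I -> V)
    (l : seq I) (p : V -> R) : sublinear p ->
  exists q : V -> R, [/\ sublinear q, forall u, q u <= p u &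
    forall i, List.In i l -> q (- e i) <= - q (e i)].
Proof.
move=> p_sub; elim: l => [|i l [q [q_sub le_qp ql]]]; first by exists p.
have [q' [q'_sub le_q'q q'i]] := sublinear_linearize q_sub (e i).
exists q'; split=> // [u|j [<-//|/ql qj]]; first exact: le_trans (le_qp u).
by have := le_q'q (- e j); have := le_q'q (e j); lra.
Qed.

Lemma sublinear_dominates n (p : 'rV[R]_n -> R) : sublinear p ->
  exists eta, forall u, dotv eta u <= p u.
Proof.
move=> p_sub.
have [q [q_sub le_qp q_lin]] :=
  sublinear_linearize_seq (fun j => delta_mx 0 j) (enum 'I_n) p_sub.
have qN j : q (- delta_mx 0 j) <= - q (delta_mx 0 j).
  apply: q_lin; move: (mem_enum 'I_n j); rewrite inE.
  elim: (enum _) => //= k l IHl; rewrite inE => /orP[/eqP->|/IHl];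
    by [left|right].
exists (\row_j q (delta_mx 0 j)) => u; apply: le_trans (le_qp u).
(* It remains to bound q(-u) from above, by expanding -u along the vectors -e_j; the sign of each
   coordinate decides whether homogeneity is applied at -e_j or at e_j. *)
apply: le_trans (sublinear_ge q_sub u); rewrite lerNr.
have -> : - u = \sum_j u 0 j *: - delta_mx 0 j.
  by rewrite {1}(row_sum_delta u) -sumrN; apply: eq_bigr => j _;
    rewrite scalerN.
case: (q_sub) => qD qZ.
rewrite /dotv -sumrN.
apply: (big_ind2 (fun x a => q x <= a)) => [|x a y b xa yb|j _].
- by rewrite sublinear0.
- by have := qD x y; lra.
- rewrite mxE; have [uj_ge0|uj_lt0] := leP 0 (u 0 j).
    have := qZ _ (- delta_mx 0 j) uj_ge0.
    by have := ler_wpM2l uj_ge0 (qN j); lra.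
  have uj_ge0 : 0 <= - u 0 j by lra.
  by rewrite scalerN -scaleNr; have := qZ _ (delta_mx 0 j) uj_ge0; lra.
Qed.

End FiniteDimensionalHahnBanach.

(** * Existence of subgradients and bounds for them *)

Section Subgradient.
Variables (R : realType) (n : nat).

Lemma convex_setE (E : lmodType R) (D : set E) (a b : R) (x y : E) :
  convex_set D -> 0 <= a -> 0 <= b -> a + b = 1 -> D x -> D y ->
  D (a *: x + b *: y).
Proof.
move=> D_conv a_ge0 b_ge0 ab1 Dx Dy.
have a_le1 : a <= 1 by lra.
have := D_conv x y (Itv01 a_ge0 a_le1); rewrite !inE => /(_ Dx Dy).
rewrite /conv/=; suff -> : b = 1 - a by [].
by lra.
Qed.

Lemma convex_functionE (E : lmodType R) (D : set E) (phi : E -> R)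
    (a b : R) (x y : E) :
  convex_function D phi -> 0 <= a -> 0 <= b -> a + b = 1 -> D x -> D y ->
  phi (a *: x + b *: y) <= a * phi x + b * phi y.
Proof.
move=> phi_conv a_ge0 b_ge0 ab1 Dx Dy.
have a_le1 : a <= 1 by lra.
have := phi_conv (Itv01 a_ge0 a_le1) x y; rewrite !inE => /(_ Dx Dy).
rewrite /conv/=; suff -> : b = 1 - a by [].
by lra.
Qed.

Lemma open_line (D : set 'rV[R]_n) x u :
  open D -> D x -> exists2 t : R, 0 < t & D (x + t *: u).
Proof.
move=> D_open Dx.
have /nbhs_ballP[e /= e_gt0 De] := open_nbhs_nbhs (conj D_open Dx).
(* The added 1 keeps the divisor positive when [u] is zero. *)
have nu_gt0 : 0 < `|u| + 1 by rewrite ltr_wpDl.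
exists (e / 2 / (`|u| + 1)); first by rewrite !divr_gt0.
apply: De; rewrite -ball_normE /ball_/= opprD addNKr normrN normrZ.
rewrite ger0_norm ?divr_ge0 ?ltW// mulrAC ltr_pdivrMr// .
have := normr_ge0 u; nra.
Qed.

(** The directional derivative, an infimum of difference quotients, is sublinear; a linear
    functional below it is a subgradient. *)
Lemma subdifferential_nonempty (D : set 'rV[R]_n) (phi : 'rV[R]_n -> R) x :
  open D -> convex_set D -> convex_function D phi -> D x ->
  subdifferential D phi x !=set0.
Proof.
move=> D_open D_conv phi_conv Dx.
pose S u := [set (phi (x + t *: u) - phi x) / t |
  t in [set t | 0 < t /\ D (x + t *: u)]].
have S_inf u : has_inf (S u).
  split.
    have [t t_gt0 Dt] := open_line u D_open Dx.
    by exists ((phi (x + t *: u) - phi x) / t); exists t.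
  (* [x] lies between x + t u and x - s u, so by convexity every forward quotient is at least this
     fixed backward one. *)
  have [s s_gt0] := open_line (- u) D_open Dx; rewrite scalerN => Ds.
  exists ((phi x - phi (x - s *: u)) / s) => _ [t [t_gt0 Dt] <-].
  have st_gt0 : 0 < s + t by lra.
  have a_ge0 : 0 <= s / (s + t) by rewrite divr_ge0// ltW.
  have b_ge0 : 0 <= t / (s + t) by rewrite divr_ge0// ltW.
  have ab1 : s / (s + t) + t / (s + t) = 1 by field; rewrite gt_eqF.
  have := convex_functionE phi_conv a_ge0 b_ge0 ab1 Dt Ds.
  have -> : (s / (s + t)) *: (x + t *: u) + (t / (s + t)) *: (x - s *: u) = x.
    by apply/rowP => j; rewrite !mxE; field; rewrite gt_eqF.
  move=> le_phi.
  rewrite ler_pdivrMr// mulrAC ler_pdivlMr//.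
  have : phi x * (s + t) <= s * phi (x + t *: u) + t * phi (x - s *: u).
    rewrite -ler_pdivlMr//; apply: le_trans le_phi _.
    by rewrite le_eqVlt; apply/orP; left; apply/eqP; field; rewrite gt_eqF.
  by lra.
have p_sub : sublinear (fun u => inf (S u)).
  apply: sublinear_inf => // [u v _ _ [s [s_gt0 Ds] <-] [t [t_gt0 Dt] <-]|].
    have st_gt0 : 0 < s + t by lra.
    have a_ge0 : 0 <= t / (s + t) by rewrite divr_ge0// ltW.
    have b_ge0 : 0 <= s / (s + t) by rewrite divr_ge0// ltW.
    have ab1 : t / (s + t) + s / (s + t) = 1 by field; rewrite gt_eqF.
    (* These weights give [u] and [v] the same coefficient, which is the step of the quotient at u +
       v. *)
    have E : (t / (s + t)) *: (x + s *: u) + (s / (s + t)) *: (x + t *: v) =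
        x + (s * t / (s + t)) *: (u + v).
      by apply/rowP => j; rewrite !mxE; field; rewrite gt_eqF.
    have r_gt0 : 0 < s * t / (s + t) by rewrite divr_gt0// mulr_gt0.
    have := convex_functionE phi_conv a_ge0 b_ge0 ab1 Ds Dt.
    have := convex_setE D_conv a_ge0 b_ge0 ab1 Ds Dt.
    rewrite {}E => Dr le_phi; eexists; first by exists (s * t / (s + t)).
    rewrite ler_pdivrMr// lerBlDr; apply: le_trans le_phi _.
    by rewrite le_eqVlt; apply/orP; left; apply/eqP; field; rewrite !gt_eqF.
  move=> c u _ c_ge0 [t [t_gt0 Dt] <-].
  move: c_ge0; rewrite le_eqVlt => /orP[/eqP<-|c_gt0].
    exists 0; last by rewrite mul0r.
    by exists 1; rewrite /= ?scale0r ?scaler0 ?addr0 ?subrr ?mul0r.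
  exists ((phi (x + (t / c) *: (c *: u)) - phi x) / (t / c)).
    exists (t / c) => //=; split; first by rewrite divr_gt0.
    by rewrite scalerA divfK ?gt_eqF.
  rewrite scalerA divfK ?gt_eqF// le_eqVlt; apply/orP; left; apply/eqP; field.
  by rewrite !gt_eqF.
have [eta le_eta] := sublinear_dominates p_sub; exists eta => y Dy.
have : inf (S (y - x)) <= phi y - phi x.
  apply: ge_inf; first by case: (S_inf (y - x)).
  (* The quotient of step 1 towards [y] is phi(y) - phi(x). *)
  have E : x + 1 *: (y - x) = y by rewrite scale1r addrC subrK.
  by exists 1; rewrite /= E ?divr1.
by have := le_eta (y - x); lra.
Qed.

Lemma norm_coord_le_enorm (u : 'rV[R]_n) j : `|u 0 j| <= enorm u.
Proof.
rewrite /enorm -sqrtr_sqr ler_wsqrtr// /dotv (bigD1 j)//= -expr2 lerDl.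
by apply: sumr_ge0 => k _; rewrite -expr2 sqr_ge0.
Qed.

Lemma norm_coord_le (u : 'rV[R]_n) j : `|u 0 j| <= `|u|.
Proof.
rewrite [leRHS]/Num.norm /= mx_normrE; apply/bigmax_geP; right.
by exists (0, j).
Qed.

(** The norm of [u] is the sup norm, hence the factor [n]. *)
Lemma dotv_le (B : R) (eta u : 'rV[R]_n) : enorm eta <= B ->
  dotv eta u <= n%:R * B * `|u|.
Proof.
move=> eta_le; have -> : n%:R * B * `|u| = \sum_(j < n) B * `|u|.
  by rewrite sumr_const card_ord -mulrA mulr_natl.
apply: ler_sum => j _; apply: le_trans (ler_norm _) _; rewrite normrM.
apply: ler_pM => //; first exact: le_trans (norm_coord_le_enorm _ _) eta_le.
exact: norm_coord_le.
Qed.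

End Subgradient.

(** * The program: bounds, raised points, convex combinations *)

Lemma widen_neq_max m (i : 'I_m) : (widen_ord (leqnSn m) i == ord_max) = false.
Proof. by apply/negbTE; rewrite -val_eqE/= neq_ltn ltn_ord. Qed.

Section Program.
Variables (R : realType) (n m : nat) (P : problem R n m) (B : R).
Hypothesis P_ok : assumptions P B.
Implicit Types (x y : Defs.point R n m) (s : 'rV[R]_n) (i : 'I_m).

Let m_gt0R : 0 < m%:R :> R. Proof. by rewrite ltr0n; case: P_ok. Qed.
Let B_pos : 0 < B. Proof. by case: P_ok. Qed.
Let C12 : C1 P < C2 P. Proof. by case: P_ok. Qed.
Let r0_pos : 0 < r0 P. Proof. by case: P_ok. Qed.

Lemma h_itv theta s : Theta P theta -> Xi P s -> C1 P <= h P theta s <= C2 P.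
Proof. by move=> *; apply: (h_bounded P_ok). Qed.

Lemma dist_sample_ge0 s i : Xi P s -> 0 <= d P s (sample P i).
Proof.
case: (d_metric P_ok) => d_ge0 _ _ _ Xs.
by apply: d_ge0 => //; apply: (sample_in P_ok).
Qed.

Lemma has_sup_h theta : Theta P theta ->
  has_sup [set h P p.1 p.2 | p in Theta P `*` Xi P].
Proof.
move=> Th; split.
  exists (h P theta (sample P (Ordinal (m_gt0 P_ok)))).
  exists (theta, sample P (Ordinal (m_gt0 P_ok))) => //=.
  by split=> //; apply: (sample_in P_ok).
by exists (C2 P) => _ [[th s] [/= Th' Xs] <-]; have /andP[] := h_itv Th' Xs.
Qed.

Lemma h_le_sup theta s : Theta P theta -> Xi P s -> h P theta s <= h_sup P.
Proof.
move=> Th Xs; apply: ub_le_sup; first by case: (has_sup_h Th).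
by exists (theta, s).
Qed.

(** A subgradient at [theta1], bounded through [B], controls the difference with a constant
    independent of [s]. *)
Lemma h_lipschitz_Theta theta1 theta2 s :
  Theta P theta1 -> Theta P theta2 -> Xi P s ->
  h P theta1 s - h P theta2 s <= n%:R * B * `|theta1 - theta2|.
Proof.
move=> Th1 Th2 Xs.
have [eta eta_sub] := subdifferential_nonempty (Omega_open P_ok)
  (Omega_convex P_ok) (h_convex P_ok Xs) (Theta_sub_Omega P_ok Th1).
have eta_le := ltW (B_subgradient P_ok Th1 Xs eta_sub).
have := eta_sub theta2 (Theta_sub_Omega P_ok Th2).
have := dotv_le (theta1 - theta2) eta_le.
have -> : dotv eta (theta2 - theta1) = - dotv eta (theta1 - theta2).
  by rewrite /dotv -sumrN; apply: eq_bigr => j _; rewrite !mxE; ring.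
by lra.
Qed.

Lemma X_vi x i : X P x -> C1 P <= vi x.2 i <= m.+1%:R * C2 P - m%:R * C1 P.
Proof. by move=> [_ []]. Qed.

Lemma X_vlast x : X P x -> 0 <= vlast x.2 <= (C2 P - C1 P) / r0 P.
Proof. by move=> [_ []]. Qed.

Lemma mean_le (F G : 'I_m -> R) : (forall i, F i <= G i) ->
  m%:R^-1 * (\sum_i F i) <= m%:R^-1 * (\sum_i G i).
Proof. by move=> FG; rewrite ler_wpM2l ?invr_ge0//; apply: ler_sum. Qed.

Lemma mean_const (c : R) : m%:R^-1 * (\sum_(i < m) c) = c.
Proof. by rewrite sumr_const card_ord -(mulr_natl c) mulKf ?gt_eqF. Qed.

Lemma f_itv x : X P x ->
  C1 P <= f P x <= m.+1%:R * C2 P - m%:R * C1 P + (C2 P - C1 P).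
Proof.
move=> Xx; have /andP[v_ge0 v_le] := X_vlast Xx; rewrite /f.
have := mulr_ge0 (ltW r0_pos) v_ge0.
have : r0 P * vlast x.2 <= C2 P - C1 P by rewrite mulrC -ler_pdivlMr.
have : m%:R^-1 * (\sum_(i < m) C1 P) <= m%:R^-1 * (\sum_(i < m) vi x.2 i).
  by apply: mean_le => i; have /andP[] := X_vi i Xx.
have : m%:R^-1 * (\sum_(i < m) vi x.2 i) <=
    m%:R^-1 * (\sum_(i < m) (m.+1%:R * C2 P - m%:R * C1 P)).
  by apply: mean_le => i; have /andP[] := X_vi i Xx.
rewrite !mean_const; lra.
Qed.

(* The coordinates [v_i] are truncated at the upper bound of the box, where
   the constraints have slack at least [m (C2 - C1)]. *)
Definition raise (delta : R) x : Defs.point R n m :=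
  (x.1, \row_(j < m.+1)
    if j == ord_max then x.2 0 j
    else Num.min (x.2 0 j + delta) (m.+1%:R * C2 P - m%:R * C1 P)).

Lemma vi_raise delta x i : vi (raise delta x).2 i =
  Num.min (vi x.2 i + delta) (m.+1%:R * C2 P - m%:R * C1 P).
Proof. by rewrite /vi mxE widen_neq_max. Qed.

Lemma vlast_raise delta x : vlast (raise delta x).2 = vlast x.2.
Proof. by rewrite /vlast mxE eqxx. Qed.

(** Displays the upper end of the box as [C2] plus the slack of a truncated coordinate. *)
Lemma box_upperE : C2 P + m%:R * (C2 P - C1 P) = m.+1%:R * C2 P - m%:R * C1 P.
Proof. by rewrite -natr1; ring. Qed.

Lemma raise_X delta x : 0 <= delta -> X P x -> X P (raise delta x).
Proof.
move=> delta_ge0 Xx; split; first by case: Xx.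
split=> [i|]; last by rewrite vlast_raise; exact: X_vlast.
have /andP[v_ge v_le] := X_vi i Xx; rewrite vi_raise ge_min lexx orbT andbT.
by rewrite le_min; apply/andP; split; lra.
Qed.

Lemma f_raise delta x : f P (raise delta x) <= f P x + delta.
Proof.
rewrite /f vlast_raise addrAC lerD2r -[in leRHS](mean_const delta).
rewrite -mulrDr -big_split/=.
by apply: mean_le => i; rewrite vi_raise ge_min lexx.
Qed.

Lemma g_raise delta x i s : delta <= m%:R * (C2 P - C1 P) ->
  feasible P x -> Xi P s -> g P i (raise delta x) s <= - delta.
Proof.
move=> delta_le [Xx gx] Xs; have := gx i s Xs.
have /andP[_ h_le] := h_itv Xx.1 Xs.
have /andP[v_ge0 _] := X_vlast Xx.
have := mulr_ge0 v_ge0 (dist_sample_ge0 i Xs).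
rewrite /g vlast_raise vi_raise -box_upperE /=.
by case: (leP (vi x.2 i + delta)); lra.
Qed.

(** All v_i equal to the supremum of [h] and last coordinate 0: the feasible set is nonempty, and
    [fstar] lies below any strict upper bound [U] of that supremum. *)
Lemma sup_feasible theta : Theta P theta ->
  exists2 x, feasible P x & f P x = h_sup P.
Proof.
move=> Th; pose x : Defs.point R n m :=
  (theta, \row_(j < m.+1) if j == ord_max then 0 else h_sup P).
have vx i : vi x.2 i = h_sup P by rewrite /vi mxE widen_neq_max.
have vlx : vlast x.2 = 0 by rewrite /vlast mxE eqxx.
have Xi0 := sample_in P_ok (Ordinal (m_gt0 P_ok)).
have /andP[hs_ge _] := h_itv Th Xi0.
have le_hs := h_le_sup Th Xi0.
have hs_le : h_sup P <= C2 P.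
  apply: ge_sup => [|_ [[th s] [/= Th' Xs] <-]]; first by case: (has_sup_h Th).
  by have /andP[] := h_itv Th' Xs.
exists x; last first.
  by rewrite /f vlx mulr0 addr0 (eq_bigr (fun=> h_sup P)) ?mean_const.
split=> [|i s Xs].
  split=> //; split=> [i|]; rewrite ?vx ?vlx.
    rewrite -box_upperE.
    have : 0 <= m%:R * (C2 P - C1 P) by rewrite mulr_ge0// ?subr_ge0 ltW.
    move=> ?; apply/andP; split; first exact: le_trans le_hs.
    by apply: le_trans hs_le _; rewrite lerDl.
  by rewrite lexx divr_ge0// ?subr_ge0 ltW.
by rewrite /g vx vlx mul0r; have := h_le_sup Th Xs; rewrite /=; lra.
Qed.

Lemma feasible_ge_fstar x : feasible P x -> fstar P <= f P x.
Proof.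
move=> Fx; apply: ge_inf; last by exists x.
by exists (C1 P) => _ [y [Xy _] <-]; have /andP[] := f_itv Xy.
Qed.

Lemma fstar_ge theta : Theta P theta -> C1 P <= fstar P.
Proof.
move=> Th; have [x Fx _] := sup_feasible Th.
apply: lb_le_inf; first by exists (f P x), x.
by move=> _ [y [Xy _] <-]; have /andP[] := f_itv Xy.
Qed.

Lemma fstar_le_sup theta : Theta P theta -> fstar P <= h_sup P.
Proof. by move=> /sup_feasible[x /feasible_ge_fstar ? <-]. Qed.

(** Nearly optimal feasible points take the place of a minimizer in what follows. *)
Lemma fstar_adherent theta delta : Theta P theta -> 0 < delta ->
  exists2 x, feasible P x & f P x < fstar P + delta.
Proof.
move=> Th delta_gt0; have [x Fx _] := sup_feasible Th.
have f_inf : has_inf (f P @` feasible P).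
  split; first by exists (f P x), x.
  by exists (C1 P) => _ [y [Xy _] <-]; have /andP[] := f_itv Xy.
by have [_ [y Fy <-] ?] := inf_adherent delta_gt0 f_inf; exists y.
Qed.

Definition mix (a b : R) x y : Defs.point R n m :=
  (a *: x.1 + b *: y.1, a *: x.2 + b *: y.2).

Section Mix.
Variables (a b : R) (x y : Defs.point R n m).
Hypotheses (a_ge0 : 0 <= a) (b_ge0 : 0 <= b) (ab1 : a + b = 1).

Lemma vi_mix i : vi (mix a b x y).2 i = a * vi x.2 i + b * vi y.2 i.
Proof. by rewrite /vi !mxE. Qed.

Lemma vlast_mix : vlast (mix a b x y).2 = a * vlast x.2 + b * vlast y.2.
Proof. by rewrite /vlast !mxE. Qed.

Lemma f_mix : f P (mix a b x y) = a * f P x + b * f P y.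
Proof.
rewrite /f vlast_mix (eq_bigr _ (fun i _ => vi_mix i)) big_split/=.
by rewrite -!mulr_sumr; ring.
Qed.

Lemma mix_itv (c e u v : R) : c <= u <= e -> c <= v <= e ->
  c <= a * u + b * v <= e.
Proof.
move=> /andP[cu ue] /andP[cv ve].
rewrite -[c]mul1r -[e]mul1r -ab1 !mulrDl.
by rewrite !lerD// ler_wpM2l.
Qed.

Hypotheses (Xx : X P x) (Xy : X P y).

Lemma mix_X : X P (mix a b x y).
Proof.
split; first exact: (convex_setE (Theta_convex P_ok) a_ge0 b_ge0 ab1 Xx.1 Xy.1).
split=> [i|]; first by rewrite vi_mix; apply: mix_itv; exact: X_vi.
by rewrite vlast_mix; apply: mix_itv; exact: X_vlast.
Qed.

Lemma g_mix i s : Xi P s ->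
  g P i (mix a b x y) s <= a * g P i x s + b * g P i y s.
Proof.
move=> Xs; have := convex_functionE (h_convex P_ok Xs) a_ge0 b_ge0 ab1
  (Theta_sub_Omega P_ok Xx.1) (Theta_sub_Omega P_ok Xy.1).
by rewrite /g vi_mix vlast_mix /=; lra.
Qed.

End Mix.
End Program.

(** * Compactness and accumulation points *)

Section Compactness.
Variables (R : realType) (n m : nat) (P : problem R n m) (B : R).
Hypothesis P_ok : assumptions P B.
Implicit Types (x y p : Defs.point R n m) (u : nat -> Defs.point R n m).
Implicit Types (s : 'rV[R]_n) (i : 'I_m).

Lemma compact_X : compact (X P).
Proof.
apply: compact_setX; first exact: Theta_compact P_ok.
(* The box is a product of segments, one per coordinate. *)
pose A (j : 'I_m.+1) := if j == ord_max
  then `[0, (C2 P - C1 P) / r0 P]%classic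
  else `[C1 P, m.+1%:R * C2 P - m%:R * C1 P]%classic.
suff -> : Hbox P = [set v | forall j, A j (v ord0 j)].
  by apply: rV_compact => j; rewrite /A; case: ifP => _; exact: segment_compact.
apply/seteqP; split=> v /=.
  move=> [vP v_last] j; rewrite /A; case: ifPn => [/eqP->|j_neq];
    rewrite /= in_itv//=.
  have j_lt : (j < m)%N.
    by rewrite ltn_neqAle -ltnS ltn_ord andbT; apply: contra j_neq => /eqP jm;
      apply/eqP/val_inj.
  by have := vP (Ordinal j_lt); congr (_ <= v _ _ <= _); apply: val_inj.
move=> vA; split=> [i|].
  by have := vA (widen_ord (leqnSn m) i); rewrite /A widen_neq_max /= in_itv.
by have := vA ord_max; rewrite /A eqxx /= in_itv.
Qed.

Lemma cluster_seq u p (K : nat) (e : R) : cluster (u @ \oo) p -> 0 < e ->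
  exists2 k, (K <= k)%N & `|p.1 - (u k).1| < e /\ `|p.2 - (u k).2| < e.
Proof.
move=> u_p e_gt0.
have uK : (u @ \oo) (u @` [set k | (K <= k)%N]).
  by exists K => // k /= Kk; exists k.
have [_ [[k /= Kk <-] [pk1 pk2]]] := u_p _ _ uK (nbhsx_ballx p e e_gt0).
by exists k => //; split; [move: pk1|move: pk2]; rewrite -ball_normE.
Qed.

Lemma exists_cluster u (K : nat) : (forall k, (K <= k)%N -> X P (u k)) ->
  exists p, cluster (u @ \oo) p.
Proof.
move=> uX; have uXF : (u @ \oo) (X P) by exists K => // k /= /uX.
by have [p [_ ?]] := compact_X _ uXF; exists p.
Qed.

Lemma vi_lipschitz x y i : vi x.2 i - vi y.2 i <= `|x.2 - y.2|.
Proof.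
apply: le_trans (ler_norm _) _.
have := norm_coord_le (x.2 - y.2) (widen_ord (leqnSn m) i).
by rewrite !mxE.
Qed.

Lemma vlast_lipschitz x y : vlast x.2 - vlast y.2 <= `|x.2 - y.2|.
Proof.
apply: le_trans (ler_norm _) _.
by have := norm_coord_le (x.2 - y.2) ord_max; rewrite !mxE.
Qed.

(** The change of the last coordinate keeps its sign and its distance factor, as no bound on that
    distance uniform in [s] is at hand. *)
Lemma g_diff x y i s : X P x -> X P y -> Xi P s ->
  g P i x s - g P i y s <= n%:R * B * `|x.1 - y.1| + `|x.2 - y.2| +
    (vlast y.2 - vlast x.2) * d P s (sample P i).
Proof.
move=> Xx Xy Xs; have := h_lipschitz_Theta P_ok Xx.1 Xy.1 Xs.
by have := vi_lipschitz y x i; rewrite /g distrC; lra.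
Qed.

Lemma f_diff x y : f P x - f P y <= (1 + r0 P) * `|x.2 - y.2|.
Proof.
have : r0 P * (vlast x.2 - vlast y.2) <= r0 P * `|x.2 - y.2|.
  by rewrite ler_wpM2l ?vlast_lipschitz ?ltW ?(r0_gt0 P_ok).
have : m%:R^-1 * (\sum_i vi x.2 i) <=
    m%:R^-1 * (\sum_i (vi y.2 i + `|x.2 - y.2|)).
  by apply: mean_le => i; have := vi_lipschitz x y i; lra.
by rewrite big_split mulrDr (mean_const P_ok) /f; lra.
Qed.

Lemma cluster_eps_optimal (eps : R) u p : cluster (u @ \oo) p ->
  (forall delta, 0 < delta -> exists K, forall k, (K <= k)%N ->
    eps_feasible P eps (u k) /\ f P (u k) <= fstar P + delta) ->
  eps_optimal P eps p.
Proof.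
move=> u_p u_opt.
have NB_ge0 : 0 <= n%:R * B by rewrite mulr_ge0// ltW// (B_gt0 P_ok).
have Xp : X P p.
  have [K uK] := u_opt 1 ltr01.
  have X_closed : closed (X P).
    exact: compact_closed (@norm_hausdorff _ _) compact_X.
  apply: X_closed; move: u_p; rewrite clusterE; apply.
  by exists K => // k /= /uK[[]].
split; first split=> // i s Xs.
  have D_ge0 := dist_sample_ge0 P_ok i Xs; set D := d P _ _ in D_ge0.
  apply/ler_addgt0Pr => delta delta_gt0.
  (* A Lipschitz constant of the constraint; it may depend on [s], which is fixed while the limit is
     taken. *)
  have c_gt0 : 0 < n%:R * B + 1 + D by lra.
  have [K uK] := u_opt 1 ltr01.
  have [k Kk [pk1 pk2]] := cluster_seq K u_p (divr_gt0 delta_gt0 c_gt0).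
  have [[Xuk /(_ i s Xs) guk] _] := uK _ Kk.
  have := g_diff i Xp Xuk Xs; rewrite -/D.
  have : (vlast (u k).2 - vlast p.2) * D <= `|p.2 - (u k).2| * D.
    by rewrite ler_wpM2r// distrC vlast_lipschitz.
  move: pk1 pk2; set a := `|_|; set b := `|_| => a_lt b_lt.
  have := ler_wpM2l NB_ge0 (ltW a_lt); have := ler_wpM2r D_ge0 (ltW b_lt).
  have : (n%:R * B + 1 + D) * (delta / (n%:R * B + 1 + D)) = delta.
    by rewrite mulrC divfK ?gt_eqF.
  by lra.
apply/ler_addgt0Pr => delta delta_gt0.
have c_gt0 : 0 < 1 + r0 P by have := r0_gt0 P_ok; lra.
(* Half of [delta] pays for near-optimality of [u k], half for its distance from [p]. *)
have [K uK] := u_opt _ (divr_gt0 delta_gt0 (ltr0Sn R 1)).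
have delta'_gt0 : 0 < delta / 2 / (1 + r0 P) by rewrite !divr_gt0.
have [k Kk [_ pk2]] := cluster_seq K u_p delta'_gt0.
have [_ fuk] := uK _ Kk.
have := f_diff p (u k); have := ler_wpM2l (ltW c_gt0) (ltW pk2).
have : (1 + r0 P) * (delta / 2 / (1 + r0 P)) = delta / 2.
  by rewrite mulrC divfK ?gt_eqF.
by lra.
Qed.

(* [d P s (sample P i)] need not be bounded over [s]. If the iterates
   accumulate somewhere, then [l < k] with [x l] and [x k] near that point have
   [vlast (x k) - vlast (x l)] bounded below by a multiple of [vlast (x l)]:
   the distances on which a difference in [vlast] acts are at most
   [(C2 - C1) / vlast (x l)], as the cut [s l] is violated at [x l]. *)
Lemma no_separated_cuts u (s : nat -> 'rV[R]_n) (c : R) (K : nat) :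
  0 < c ->
  (forall k, (K <= k)%N -> X P (u k) /\ Xi P (s k)) ->
  (forall l, (K <= l)%N -> exists2 i, 0 < g P i (u l) (s l) &
    forall k, (l < k)%N -> g P i (u k) (s l) <= - c) -> False.
Proof.
move=> c_gt0 uX sep.
have NB_ge0 : 0 <= n%:R * B by rewrite mulr_ge0// ltW// (B_gt0 P_ok).
have C_gt0 : 0 < C2 P - C1 P by rewrite subr_gt0 (C1_lt_C2 P_ok).
have [p u_p] := exists_cluster (fun k Kk => (uX k Kk).1).
(* Two points within [e] of [p] are at most 2e apart, which accounts for c/2 in [g_diff] and leaves
   c/2 to the last coordinate. *)
pose e := c / (4 * (n%:R * B + 1)).
have e_gt0 : 0 < e by rewrite divr_gt0 ?mulr_gt0//; lra.
have eE : 4 * (n%:R * B + 1) * e = c.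
  by rewrite mulrC divfK// gt_eqF// mulr_gt0//; lra.
pose near e' k := `|p.1 - (u k).1| < e' /\ `|p.2 - (u k).2| < e'.
have grow l k : (K <= l)%N -> (l < k)%N -> near e l -> near e k ->
    vlast (u l).2 < vlast (u k).2 /\
    vlast (u l).2 * (c / 2) <= (C2 P - C1 P) * (vlast (u k).2 - vlast (u l).2).
  move=> Kl lk [l1 l2] [k1 k2]; have [i gl /(_ k lk) gk] := sep l Kl.
  have [Xl Xsl] := uX l Kl; have [Xk _] := uX k (leq_trans Kl (ltnW lk)).
  have D_ge0 := dist_sample_ge0 P_ok i Xsl; set D := d P _ _ in D_ge0.
  have dist1 : `|(u l).1 - (u k).1| <= 2 * e.
    by apply: le_trans (ler_distD p.1 _ _) _; move: l1; rewrite distrC; lra.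
  have dist2 : `|(u l).2 - (u k).2| <= 2 * e.
    by apply: le_trans (ler_distD p.2 _ _) _; move: l2; rewrite distrC; lra.
  have dv_gt : c / 2 < (vlast (u k).2 - vlast (u l).2) * D.
    have := g_diff i Xl Xk Xsl; rewrite -/D.
    by have := ler_wpM2l NB_ge0 dist1; lra.
  have dv_gt0 : vlast (u l).2 < vlast (u k).2.
    by rewrite ltNge; apply/negP => le_v; nra.
  split=> //.
  have /andP[vl_ge0 _] := X_vlast Xl.
  (* Violation at [u l] bounds this product by h - v_i. *)
  have vlD : vlast (u l).2 * D <= C2 P - C1 P.
    have /andP[_ h_le] := h_itv P_ok Xl.1 Xsl.
    by have /andP[vi_ge _] := X_vi i Xl; move: gl; rewrite /g -/D; lra.
  have := ler_wpM2l vl_ge0 (ltW dv_gt).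
  have dv_ge0 : 0 <= vlast (u k).2 - vlast (u l).2 by lra.
  have := ler_wpM2r dv_ge0 vlD.
  by lra.
(* The first pair only makes the last coordinate at [l2] positive, so that the growth estimate has
   content from there on. *)
have [l1 Kl1 near_l1] := cluster_seq K u_p e_gt0.
have [l2 l12 near_l2] := cluster_seq l1.+1 u_p e_gt0.
have [a_gt _] := grow _ _ Kl1 l12 near_l1 near_l2.
have /andP[vl1_ge0 _] := X_vlast (uX l1 Kl1).1.
set a := vlast (u l2).2 in a_gt.
have Kl2 : (K <= l2)%N by rewrite (leq_trans Kl1)// ltnW.
(* Within [e'] of [p], last coordinates differ by less than a c / (2 (C2 - C1)), while [grow] forces
   a larger increase from [l3] to [l4]. *)
pose e' := Num.min e (a * c / (4 * (C2 P - C1 P))).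
have e'_gt0 : 0 < e'.
  by rewrite lt_min e_gt0 divr_gt0 ?mulr_gt0//; lra.
have near_e' k : near e' k -> near e k.
  by rewrite /near !lt_min => -[/andP[? _] /andP[? _]].
have [l3 l23 near_l3] := cluster_seq l2.+1 u_p e'_gt0.
have [l4 l34 near_l4] := cluster_seq l3.+1 u_p e'_gt0.
have Kl3 : (K <= l3)%N by rewrite (leq_trans Kl2)// ltnW.
have [a_lt _] := grow _ _ Kl2 l23 near_l2 (near_e' _ near_l3).
have [_] := grow _ _ Kl3 l34 (near_e' _ near_l3) (near_e' _ near_l4).
have : vlast (u l4).2 - vlast (u l3).2 < 2 * (a * c / (4 * (C2 P - C1 P))).
  have := vlast_lipschitz (u l4) p; have := vlast_lipschitz p (u l3).
  move: near_l3 near_l4; rewrite /near !lt_min distrC.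
  move=> [_ /andP[_ n3]] [_ /andP[_ n4]].
  by rewrite (distrC (u l4).2); lra.
rewrite -(ltr_pM2l C_gt0).
have -> : (C2 P - C1 P) * (2 * (a * c / (4 * (C2 P - C1 P)))) = a * (c / 2).
  by field; rewrite gt_eqF.
have : a * (c / 2) < vlast (u l3).2 * (c / 2) by rewrite ltr_pM2r// divr_gt0.
by lra.
Qed.

End Compactness.

(** After a term within [delta] of the infimum, all terms stay in one window of length [delta],
    whatever their order. *)
Lemma nonincreasing_eventually_flat (R : realType) (u : nat -> R)
    (c delta : R) :
  (forall k, u k.+1 <= u k) -> (forall k, c <= u k) -> 0 < delta ->
  exists K, forall k l, (K <= k)%N -> (K <= l)%N -> u l < u k + delta.
Proof.
move=> u_dec c_le delta_gt0.
have u_inf : has_inf (range u).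
  by split; [exists (u 0), 0%N|exists c => _ [k _ <-]].
have [_ [K _ <-] uK] := inf_adherent delta_gt0 u_inf.
exists K => k l Kk Kl.
apply: le_lt_trans ((nonincreasing_seqP u).1 u_dec _ _ Kl) _.
apply: lt_le_trans uK _; rewrite lerD2r.
by apply: ge_inf; [case: u_inf|exists k].
Qed.

(** * Levels and master values along a run *)

Section Run.
Variables (R : realType) (n m : nat) (P : problem R n m).
Variables (B U eps alpha : R) (r : trace R n m).
Hypotheses (P_ok : assumptions P B) (U_gt : h_sup P < U).
Hypothesis alpha_gt1 : 1 < alpha.
Hypothesis r_run : run P B U eps alpha r.
Implicit Types (k l j : nat).

Let B_pos : 0 < B. Proof. exact: B_gt0 P_ok. Qed.
Let C_pos : 0 < m%:R * (C2 P - C1 P).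
Proof. by rewrite mulr_gt0 ?subr_gt0 ?ltr0n ?(m_gt0 P_ok) ?(C1_lt_C2 P_ok). Qed.

Lemma Theta_neq0 : Theta P !=set0.
Proof. by case: r_run => -[_ [theta0 [? _ _]] _ _ _] _ _; exists theta0. Qed.

Lemma fstar_lt_U : fstar P < U.
Proof.
have [theta Th] := Theta_neq0.
exact: le_lt_trans (fstar_le_sup P_ok Th) U_gt.
Qed.

Lemma reachedS k : reached r k.+2 -> reached r k.+1 /\ mvalue r k.+1 <> 0.
Proof.
move=> [_ r_neq0]; split; last by apply: r_neq0; rewrite ltnSn.
by split=> // j /andP[j_gt0 jk]; apply: r_neq0; rewrite j_gt0 ltnW.
Qed.

Lemma iterate_X k : reached r k -> X P (iterate r k).
Proof. by case: r_run => _ + _ => /[apply] -[[t [? _ _ _]] _]. Qed.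

(** Adding the level and objective constraints of the master problem eliminates [t]. *)
Lemma level_drop k : reached r k ->
  f P (iterate r k) <= level r k.-1 - (1 + B) * mvalue r k.
Proof.
case: r_run => _ + _ => /[apply] -[[t [_ tw fw _]] _].
by lra.
Qed.

(** Reaching [k.+2] means that iteration [k.+1] did not stop. If no oracle answer there is violated,
    the oracle tolerance makes the iterate [eps]-feasible. *)
Lemma step k : reached r k.+2 -> exists2 Q,
  [/\ feasibility_cut P r k.+1 Q, ~ update_iteration P r k.+1 &
      Xi P (cut_point r k.+1)] \/
  best_update P r k.+1 Q /\ eps_feasible P eps (iterate r k.+1) &
  cut_dropping P B alpha r k.+1 Q.
Proof.
move=> /reachedS[rk w_neq0]; case: r_run => _ _.
move=> /(_ _ rk w_neq0)[sep [Q cutQ dropQ]].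
exists Q => //; case: cutQ => [cutQ|updQ]; [left|right]; split=> //.
- case: cutQ => -[i siE g_gt0] _ _ _ [_ _ /(_ i)].
  by rewrite -siE leNgt g_gt0.
- by case: cutQ => -[i -> _] _ _ _; case: (sep i).
- split=> [|i s Xs]; first exact: iterate_X.
  case: updQ => /(_ i) g_le _ _ _; have [_ /(_ s Xs)] := sep i.
  by move: g_le; lra.
Qed.

(** The bound on labels leaves finitely many cuts at each iteration. *)
Lemma cuts_Xi k l : reached r k.+1 -> cuts r k l ->
  (l <= k)%N /\ Xi P (cut_point r l).
Proof.
elim: k l => [|k IHk] l rk.
  by case: r_run => -[_ _ _ -> ?] _ _ ->.
have cuts_sub Q : cut_dropping P B alpha r k.+1 Q -> cuts r k.+1 `<=` Q.
  by case=> ->; [|exact: subDsetl].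
have [rk' _] := reachedS rk.
have [Q Q_cases /cuts_sub QE] := step rk => /QE.
case: Q_cases => [[[_ -> _ _] _ Xk]|[[_ -> _ _] _]].
  by case=> [/(IHk _ rk')[/leqW]|->].
by move=> /(IHk _ rk')[/leqW].
Qed.

Lemma level_cases k : reached r k.+1 ->
  (level r k = U /\ forall j, (j <= k)%N -> ~ update_iteration P r j) \/
  (eps_feasible P eps (best r k) /\ f P (best r k) = level r k).
Proof.
elim: k => [|k IHk] rk.
  left; split; first by case: r_run => -[].
  by case=> // _ [[]].
have [rk' _] := reachedS rk.
have [Q Q_cases _] := step rk.
case: Q_cases => [[[_ _ -> ->] not_upd _]|[[_ _ -> ->] feas]]; last by right.
case: (IHk rk') => [[-> no_upd]|]; [left|by right].
by split=> // j; rewrite leq_eqVlt => /orP[/eqP->|/no_upd].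
Qed.

(** The raised point has slack [delta] in every cut, enough for B w, at a cost of at most [delta] in
    the objective; t = M - w makes the level constraint tight. [w] may be negative. *)
Lemma master_raise k x delta w : reached r k.+1 -> feasible P x ->
  0 <= delta <= m%:R * (C2 P - C1 P) -> B * w <= delta ->
  f P x + delta + (1 + B) * w <= level r k -> w <= mvalue r k.+1.
Proof.
move=> rk Fx /andP[delta_ge0 delta_le] Bw_le fw_le.
case: r_run => _ /(_ _ rk)[_ w_max] _.
apply: (w_max (raise P delta x) w (level r k - w)); split=> /=.
- by apply: raise_X => //; case: Fx.
- by lra.
- by have := f_raise P_ok delta x; lra.
- move=> i l /(cuts_Xi rk)[_ Xl].
  by have := g_raise P_ok i delta_le Fx Xl; lra.
Qed.

Lemma mvalue_bounded_below (M : R) : fstar P < M -> exists2 w, 0 < w &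
  forall k, reached r k.+1 -> M <= level r k -> w <= mvalue r k.+1.
Proof.
move=> M_gt; have [theta Th] := Theta_neq0.
have gap_gt0 : 0 < (M - fstar P) / 2 by rewrite divr_gt0// subr_gt0.
have [x Fx fx_lt] := fstar_adherent P_ok Th gap_gt0.
(* The gap is spent as one half on near-optimality of [x], a quarter on raising and a quarter on (1
   + B) w = [delta]. *)
pose delta := Num.min ((M - fstar P) / 4) (m%:R * (C2 P - C1 P)).
have delta_gt0 : 0 < delta by rewrite lt_min C_pos andbT; lra.
have delta_le1 : delta <= (M - fstar P) / 4 by rewrite ge_min lexx.
have delta_le2 : delta <= m%:R * (C2 P - C1 P) by rewrite ge_min lexx orbT.
have B1_gt0 : 0 < 1 + B by rewrite addr_gt0.
have wE : (1 + B) * (delta / (1 + B)) = delta by rewrite mulrC divfK// gt_eqF.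
exists (delta / (1 + B)) => [|k rk M_le]; first by rewrite divr_gt0.
have w_gt0 : 0 < delta / (1 + B) by rewrite divr_gt0.
apply: (@master_raise k x delta) => //; last by lra.
- by rewrite ltW.
- by rewrite mulrDl mul1r in wE; lra.
Qed.

Lemma mvalue_gt0 k : reached r k.+1 -> fstar P < level r k -> 0 < mvalue r k.+1.
Proof.
move=> rk /mvalue_bounded_below[w w_gt0 /(_ k rk (lexx _))].
exact: lt_le_trans.
Qed.

(** A nearly optimal [x], not raised, fits the master problem with w = (M - f x) / (1 + B) <= 0;
    then [level_drop] yields f <= f x at the iterate. *)
Lemma f_iterate_le k : reached r k.+1 -> level r k <= fstar P ->
  f P (iterate r k.+1) <= fstar P.
Proof.
move=> rk M_le; apply/ler_addgt0Pr => delta delta_gt0.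
have [theta Th] := Theta_neq0.
have [x Fx fx_lt] := fstar_adherent P_ok Th delta_gt0.
have B1_gt0 : 0 < 1 + B by rewrite addr_gt0.
pose w := (level r k - f P x) / (1 + B).
have wE : (1 + B) * w = level r k - f P x by rewrite mulrC divfK// gt_eqF.
have le_fx := feasible_ge_fstar P_ok Fx.
have w_le0 : w <= 0 by rewrite pmulr_lle0 ?invr_gt0//; lra.
have : w <= mvalue r k.+1.
  apply: (@master_raise k x 0) => //; last by lra.
  - by rewrite lexx ltW.
  - by rewrite pmulr_rle0.
move=> /(ler_wpM2l (ltW B1_gt0)).
by have := level_drop rk; rewrite /=; lra.
Qed.

(** [level_nonincreasing] supposes a nonnegative master value; here the bound on each new iterate
    does its work. *)
Lemma level_le_fstar j k : (j <= k)%N -> reached r k.+1 ->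
  level r j <= fstar P -> level r k <= fstar P.
Proof.
elim: k => [|k IHk]; first by rewrite leqn0 => /eqP->.
rewrite leq_eqVlt => /orP[/eqP->//|jk] rk Mj.
have [rk' _] := reachedS rk; have Mk := IHk jk rk' Mj.
have [Q [[[_ _ _ ->] _ _]|[[_ _ _ ->] _]] _] := step rk => //.
exact: f_iterate_le.
Qed.

Lemma eps_optimal_best k : reached r k.+1 -> level r k <= fstar P ->
  eps_optimal P eps (best r k).
Proof.
move=> rk Mk; have [[MU _]|[feas fE]] := level_cases rk.
  by have := fstar_lt_U; rewrite -MU ltNge Mk.
by split=> //; rewrite fE.
Qed.

Lemma stops_eps_optimal K : stops_at r K -> eps_optimal P eps (best r K.-1).
Proof.
case: K => [[[]]//|k [rk wk0]]; apply: eps_optimal_best => //=.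
by rewrite leNgt; apply/negP => /(mvalue_gt0 rk); rewrite wk0 ltxx.
Qed.

Lemma level_nonincreasing k : reached r k.+2 -> 0 <= mvalue r k.+1 ->
  level r k.+1 <= level r k.
Proof.
move=> rk w_ge0; have [Q [[[_ _ _ ->] _ _]|[[_ _ _ ->] _]] _] := step rk => //.
have [rk' _] := reachedS rk; have := level_drop rk'; rewrite /=.
have := mulr_ge0 (ltW B_pos) w_ge0.
by lra.
Qed.

(* Dropped cuts are inactive, so by convexity the value of the master problem
   is not affected by dropping them. *)
Lemma mvalue_nonincreasing k : reached r k.+2 -> level r k.+1 <= level r k ->
  mvalue r k.+2 <= mvalue r k.+1.
Proof.
move=> rk Mk_le; have [rk' _] := reachedS rk.
have [Q Q_cases dropQ] := step rk.
have sub_Q : cuts r k `<=` Q.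
  by case: Q_cases => [[[_ -> _ _] _ _]|[[_ -> _ _] _]] //; exact: subsetUl.
case: r_run => _ r_max _.
have [[t [Xx tw fw gw]] w_max] := r_max _ rk'.
have [[t' [Xx' tw' fw' gw']] _] := r_max _ rk.
set x := iterate r k.+1 in Xx fw gw; set w := mvalue r k.+1 in tw fw gw w_max *.
set x' := iterate r k.+2 in Xx' fw' gw'.
set w' := mvalue r k.+2 in tw' fw' gw' *.
rewrite leNgt; apply/negP => w_lt.
pose c i l := g P i x (cut_point r l) + B * w.
pose c' i l := g P i x' (cut_point r l) + B * w'.
(* Finitely many strict inequalities at [x] persist for a short move towards [x']. *)
have slack : \forall z \near 0^'+, forall il : 'I_m * 'I_k.+1,
    c il.1 il.2 < 0 -> (1 - z) * c il.1 il.2 + z * c' il.1 il.2 <= 0.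
  apply: filter_forall => -[i l] /=; set a := c i l; set b := c' i l.
  have [a_lt0|a_ge0] := ltP a 0; last by near=> z.
  have ab_gt0 : 0 < - a + `|b| by rewrite ltr_wpDr// oppr_gt0.
  (* The zero of a + z (|b| - a), which dominates (1 - z) a + z b. *)
  have z0_gt0 : 0 < - a / (- a + `|b|) by rewrite divr_gt0// oppr_gt0.
  near=> z => _.
  have z_gt0 : 0 < z by near: z; exact: nbhs_right_gt.
  have z_le : z <= - a / (- a + `|b|) by near: z; exact: nbhs_right_le.
  move: z_le; rewrite ler_pdivlMr//.
  by have := ler_wpM2l (ltW z_gt0) (ler_norm b); lra.
have [z [z_gt0 z_le1 z_slack]] : exists z : R, [/\ 0 < z, z <= 1 &
    forall il : 'I_m * 'I_k.+1,
      c il.1 il.2 < 0 -> (1 - z) * c il.1 il.2 + z * c' il.1 il.2 <= 0].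
  have /filter_ex[z [zs [z_gt0 z_le1]]] : \forall z \near (0 : R)^'+,
      (forall il : 'I_m * 'I_k.+1,
        c il.1 il.2 < 0 -> (1 - z) * c il.1 il.2 + z * c' il.1 il.2 <= 0) /\
      0 < z /\ z <= 1.
    apply: filterI slack _; apply: filterI; first exact: nbhs_right_gt.
    exact: nbhs_right_le.
  by exists z.
have z1_ge0 : 0 <= 1 - z by lra.
have z1 : 1 - z + z = 1 by lra.
have z_ge0 := ltW z_gt0.
(* The mixture is feasible for the earlier master problem, whose level is no smaller, so w' > w
   would beat its optimal value. *)
have : (1 - z) * w + z * w' <= w.
  apply: (w_max (mix (1 - z) z x x') _ ((1 - z) * t + z * t')); split.
  - exact: (mix_X P_ok z1_ge0 z_ge0 z1 Xx Xx').
  - have := ler_wpM2l z1_ge0 tw; have := ler_wpM2l z_ge0 tw'.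
    by have := ler_wpM2l z_ge0 Mk_le; rewrite /=; lra.
  - have := ler_wpM2l z1_ge0 fw; have := ler_wpM2l z_ge0 fw'.
    by rewrite f_mix; lra.
  - move=> i l cut_l; have [lk Xl] := cuts_Xi rk' cut_l.
    have := g_mix P_ok z1_ge0 z_ge0 z1 Xx Xx' i Xl.
    suff : (1 - z) * c i l + z * c' i l <= 0 by rewrite /c /c'; lra.
    (* An inactive cut is covered by the choice of [z]; an active one was not droppable, so [x']
       satisfies it too. *)
    have [c_lt0|c_ge0] := ltP (c i l) 0.
      exact: (z_slack (i, Ordinal (lk : (l < k.+1)%N))).
    have c_le0 : c i l <= 0 by exact: gw.
    have kept : cuts r k.+1 l.
      case: dropQ => ->; first exact: sub_Q.
      split; first exact: sub_Q.
      by case=> _ _ _ /(_ i); rewrite -/x -/w -/(c i l) ltNge c_ge0.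
    have := ler_wpM2l z_ge0 (gw' i l kept); rewrite -/(c' i l).
    by have := ler_wpM2l z1_ge0 c_le0; lra.
have : 0 < z * (w' - w) by rewrite mulr_gt0// subr_gt0.
by lra.
Unshelve. all: by end_near.
Qed.

(** * Runs that never stop *)

Section Infinite.
Hypothesis r_infinite : never_stops r.

Let reached_all k : reached r k.+1.
Proof. by split=> // j /andP[j_gt0 _]; exact: r_infinite. Qed.

Lemma level_lower_bound k : Num.min (C1 P) U <= level r k.
Proof.
have [[-> _]|[[Xb _] <-]] := level_cases (reached_all k).
  by rewrite ge_min lexx orbT.
by rewrite ge_min; have /andP[-> _] := f_itv P_ok Xb.
Qed.

(* Were the master values bounded away from 0, they would settle within a
   factor [alpha] of each other and there would be finitely many updates; from
   then on each iteration adds a cut that is never dropped. *)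
Lemma mvalue_not_bounded_below (w0 : R) : 0 < w0 ->
  ~ forall k, w0 <= mvalue r k.+1.
Proof.
move=> w0_gt0 w0_le.
have M_dec k : level r k.+1 <= level r k.
  by apply: level_nonincreasing => //; apply: le_trans (w0_le k); exact: ltW.
have w_dec k : mvalue r k.+2 <= mvalue r k.+1 by exact: mvalue_nonincreasing.
(* With this margin w_l < w_k + (alpha - 1) w0 <= alpha w_k, which rules out dropping. *)
have drop_gt0 : 0 < (alpha - 1) * w0 by rewrite mulr_gt0// subr_gt0.
have [K1 w_flat] := nonincreasing_eventually_flat
  (u := fun k => mvalue r k.+1) w_dec w0_le drop_gt0.
(* Every update lowers the level by at least this amount. *)
have upd_gt0 : 0 < (1 + B) * w0 by rewrite mulr_gt0// addr_gt0.
have [K2 M_flat] :=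
  nonincreasing_eventually_flat M_dec level_lower_bound upd_gt0.
pose K := maxn K1 K2.
have is_cut k : (K <= k)%N -> exists2 Q,
    feasibility_cut P r k.+1 Q /\ Xi P (cut_point r k.+1) &
    cut_dropping P B alpha r k.+1 Q.
  rewrite geq_max => /andP[_ K2k].
  have [Q Q_cases dropQ] := step (reached_all k.+1).
  case: Q_cases => [[cutQ _ Xk]|[[_ _ _ ME] _]]; first by exists Q.
  have := M_flat k.+1 k (leqW K2k) K2k; have := level_drop (reached_all k).
  rewrite ME /=; have := w0_le k.
  have B1_ge0 : 0 <= 1 + B by rewrite addr_ge0// ltW.
  by move=> /(ler_wpM2l B1_ge0); lra.
have kept l k : (K <= l)%N -> (l <= k)%N -> cuts r k.+1 l.+1.
  move=> Kl; elim: k => [|k IHk] lk.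
    have l0 : l = 0%N by apply/eqP; rewrite -leqn0.
    rewrite l0 in Kl *.
    have [Q [[_ QE _ _] _] dropQ] := is_cut 0%N Kl.
    have Q1 : Q 1%N by rewrite QE; right.
    case: dropQ => ->//; split=> // -[_ _ + _].
    have : 0 < (alpha - 1) * mvalue r 1
      by rewrite mulr_gt0 ?subr_gt0//; exact: lt_le_trans (w0_le 0%N).
    by lra.
  have Kk : (K <= k.+1)%N by exact: leq_trans lk.
  have [Q [[_ QE _ _] _] dropQ] := is_cut _ Kk.
  have Ql : Q l.+1.
    rewrite QE; move: lk; rewrite leq_eqVlt.
    by move=> /orP[/eqP->|/IHk]; [right|left].
  case: dropQ => ->//; split=> // -[_ _ + _].
  have [K1l K1k] : (K1 <= l)%N /\ (K1 <= k.+1)%N.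
    by split; [move: Kl|move: Kk]; rewrite geq_max => /andP[].
  have := w_flat k.+1 l K1k K1l.
  have alpha1_ge0 : 0 <= alpha - 1 by rewrite subr_ge0 ltW.
  by have := ler_wpM2l alpha1_ge0 (w0_le k.+1); lra.
have Bw0_gt0 : 0 < B * w0 by rewrite mulr_gt0.
apply: (@no_separated_cuts _ _ _ _ _ P_ok (fun k => iterate r k.+1)
  (fun k => cut_point r k.+1) _ K Bw0_gt0) => [k Kk|l Kl].
  by split; [exact: iterate_X|case: (is_cut k Kk) => Q []].
have [Q [[[i _ g_gt0] _ _ _] Xl] _] := is_cut l Kl.
exists i => // -[//|k] lk.
(* Iterate [k.+2] solves a master problem that still contains cut [l.+1], hence satisfies it with
   margin B w >= B w0. *)
case: r_run => _ /(_ _ (reached_all k.+1))[[t [_ _ _ gw]] _] _.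
have {gw} := gw i _ (kept _ _ Kl lk).
by have := ler_wpM2l (ltW B_pos) (w0_le k.+1); lra.
Qed.

(** A level at most [fstar] settles the matter. Otherwise the levels decrease, and staying above [M]
    would bound the master values away from 0. *)
Lemma level_eventually_le (M : R) : fstar P < M ->
  exists K, forall k, (K <= k)%N -> level r k <= M.
Proof.
move=> M_gt.
have [[K MK]|M_gt_fstar] := pselect (exists K, level r K <= fstar P).
  exists K => k Kk; apply: le_trans (ltW M_gt).
  exact: level_le_fstar Kk _ MK.
have {}M_gt_fstar k : fstar P < level r k.
  by rewrite ltNge; apply/negP => ?; apply: M_gt_fstar; exists k.
have M_dec k : level r k.+1 <= level r k.
  by apply: level_nonincreasing => //; apply/ltW/mvalue_gt0.
have [w0 w0_gt0 w0_le] := mvalue_bounded_below M_gt.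
have [[K MK]|M_le] := pselect (exists K, level r K <= M).
  exists K => k Kk; apply: le_trans MK.
  exact: (nonincreasing_seqP (level r)).1 M_dec _ _ Kk.
have := mvalue_not_bounded_below w0_gt0; case => k; apply: w0_le => //.
by rewrite leNgt; apply/negP => /ltW ?; apply: M_le; exists k.
Qed.

Lemma cluster_best_eps_optimal p :
  cluster (best r @ \oo) p -> eps_optimal P eps p.
Proof.
move=> best_p; apply: (cluster_eps_optimal P_ok best_p) => delta delta_gt0.
have Md_gt : fstar P < fstar P + delta by lra.
(* A level below this midpoint is not the initial [U], so the best solution has been updated. *)
have MU_gt : fstar P < (fstar P + U) / 2 by have := fstar_lt_U; lra.
have [K1 M1] := level_eventually_le Md_gt.
have [K2 M2] := level_eventually_le MU_gt.
exists (maxn K1 K2) => k; rewrite geq_max => /andP[/M1 M1k /M2 M2k].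
have [[MU _]|[feas fE]] := level_cases (reached_all k).
  by have := fstar_lt_U; rewrite MU in M2k; lra.
by rewrite fE.
Qed.

End Infinite.

(** * The rate of convergence *)

Lemma one_step_ratio_le (L : R) k : rate_iteration P r k ->
  one_step_ratio P r k <= 1 - (2 * Bprime P B L + 1)^-1.
Proof.
case: k => [[[[]]]//|k [[rk w_neq0 no_viol] [j jk upd_j] /= gap]].
have rk2 : reached r k.+2.
  split=> // l /andP[l_gt0]; rewrite ltnS leq_eqVlt => /orP[/eqP->//|lk].
  by case: rk => _; apply; rewrite l_gt0.
(* The earlier update excludes the starting level, so the level is the value of the best
   solution. *)
have [[_ no_upd]|[[Xb _] bestE]] := level_cases rk.
  by case: (no_upd _ jk).
have [Q [[_ []//]|[[_ _ bestE' _] _]] _] := step rk2.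
rewrite /one_step_ratio bestE' /=.
have B'_ge1 : 1 <= Bprime P B L.
  rewrite /Bprime le_max -[leLHS]sqrtr1 ler_wsqrtr//.
  by rewrite -addrA addrCA lerDl addr_ge0// sqr_ge0.
set B' := Bprime P B L in B'_ge1 *.
have den_gt0 : 0 < 2 * B' + 1 by lra.
have B1_gt0 : 0 < 1 + B by rewrite addr_gt0.
set gamma := f P (best r k) - fstar P.
have gamma_gt0 : 0 < gamma by rewrite subr_gt0.
(* As B' >= 1, (1 + B) w is at most gamma/3; so near-optimality of [x], raising by B w, and (1 + B)
   w each take at most a third of the gap. *)
pose w := gamma / (2 * B' + 1) / (1 + B).
have w_gt0 : 0 < w by rewrite !divr_gt0.
have wE : (1 + B) * w = gamma / (2 * B' + 1) by rewrite mulrC divfK// gt_eqF.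
have w_le : (1 + B) * w <= gamma / 3.
  by rewrite wE ler_pM2l// lef_pV2 ?posrE//; lra.
have Bw_ge0 : 0 < B * w by rewrite mulr_gt0.
have : w <= mvalue r k.+1.
  have [theta Th] := Theta_neq0.
  have [x Fx fx_lt] := fstar_adherent P_ok Th (divr_gt0 gamma_gt0 (ltr0Sn R 2)).
  apply: (@master_raise k x (B * w)) => //.
    (* The gap is at most (m + 2)(C2 - C1), so a third of it stays within the raising range m (C2 -
       C1). *)
    rewrite ltW//=; have /andP[_ fb_le] := f_itv P_ok Xb.
    have := fstar_ge P_ok Th; rewrite -(box_upperE P) in fb_le.
    have m_ge1 : 1 <= m%:R :> R by rewrite ler1n (m_gt0 P_ok).
    have C12 := C1_lt_C2 P_ok.
    have : C2 P - C1 P <= m%:R * (C2 P - C1 P).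
      by rewrite ler_peMl// subr_ge0 ltW.
    by rewrite /gamma in w_le; lra.
  by rewrite -bestE; rewrite /gamma in w_le fx_lt *; lra.
move=> /(ler_wpM2l (ltW B1_gt0)); rewrite wE => drop_ge.
rewrite ler_pdivrMr// mulrBl mul1r [_^-1 * _]mulrC.
by have := level_drop rk; rewrite /= -bestE /gamma in drop_ge *; lra.
Qed.

End Run.

(** * Stopping or running forever, and the rate *)

Theorem theorem4p4 (R : realType) (n m : nat) (P : problem R n m)
    (B U eps alpha : R) (r : trace R n m) :
  assumptions P B ->
  h_sup P < U ->
  0 < eps ->
  1 < alpha ->
  run P B U eps alpha r ->
  ((exists K, stops_at r K /\ eps_optimal P eps (best r K.-1)) \/
   (never_stops r /\
    forall p, cluster (best r @ \oo) p -> eps_optimal P eps p)) /\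
  (forall L, is_max_distance P L ->
   forall k, rate_iteration P r k ->
     one_step_ratio P r k <= 1 - (2 * Bprime P B L + 1)^-1).
Proof.
move=> P_ok U_gt eps_gt0 alpha_gt1 r_run; split; last first.
  by move=> L _ k; exact: (one_step_ratio_le P_ok r_run).
have [[k [k_gt0 wk0]]|no_stop] :=
  pselect (exists k, (0 < k)%N /\ mvalue r k = 0).
  left; have ex_stop : exists k, (0 < k)%N && (mvalue r k == 0).
    by exists k; rewrite k_gt0 wk0 eqxx.
  (* The least zero of the master values is the iteration actually reached; later ones are
     unconstrained. *)
  case: (ex_minnP ex_stop) => K /andP[K_gt0 /eqP wK0] K_min.
  have K_stops : stops_at r K.
    split=> //; split=> // j /andP[j_gt0 jK] wj0.
    by have := K_min j; rewrite j_gt0 wj0 eqxx leqNgt jK => /(_ isT).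
  by exists K; split=> //; exact: (stops_eps_optimal P_ok _ r_run).
right; have r_infinite : never_stops r.
  by move=> k k_gt0 wk0; apply: no_stop; exists k.
by split=> // p; exact: (cluster_best_eps_optimal P_ok U_gt _ r_run).
Qed.
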